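(* For every Conway-Coxeter frieze $\Gamma$ of zigzag-type, $$\langle\bot(\Gamma)\rangle\;\dot{=}\;\langle\Gamma\rangle ,$$ where $\dot{=}$ means equality up to replacing $A$ with $A^{-1}$.
   Context: Friezes. A Conway-Coxeter frieze is an array of positive integers arranged on finitely many shifted rows (each infinite in both horizontal directions) whose top and bottom rows consist of 1's and in which every unit diamond with left entry $a$, top entry $b$, bottom entry $c$, right entry $d$ satisfies $ad-bc=1$; friezes are considered up to horizontal translation. For an $LR$ word $w$ (a finite, possibly empty, word in $L,R$) of length $\ell(w)$, $\text{CCF}(w)=\Gamma(w)$ is the unique Conway-Coxeter frieze with $\ell(w)+1$ rows between the top and bottom rows of 1's containing the following zigzag line of 1's: a 1 in the first row below the top row and then, reading the letters of $w$ from left to right, a 1 in each successive row located at the adjacent lower-left position for a letter $L$ and at the adjacent lower-right position for a letter $R$. A frieze of the form $\text{CCF}(w)$ is said to be of zigzag-type. $\bot(\Gamma)$ is the frieze obtained from $\Gamma$ by reflection in a vertical line (left-right mirror image); if $\Gamma=\text{CCF}(w)$ then $\bot(\Gamma)=\text{CCF}(i(w))$, where $i(w)$ is obtained from $w$ by exchanging $L$ and $R$. $LR$ words and rationals. Consider the part of the Stern-Brocot tree below $\frac12$: the root $\frac12$ has parents $(\frac01,\frac11)$, and a vertex $\alpha$ with parents $(y,z)$ has left child $y\sharp\alpha$ (with parents $(y,\alpha)$) and right child $\alpha\sharp z$ (with parents $(\alpha,z)$). Every $\alpha\in\mathbb{Q}\cap(0,1)$ occurs exactly once; record the downward path from $\frac12$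 to $\alpha$ as a sequence of letters $L$ (left step) and $R$ (right step), and let $w(\alpha)$ be this sequence written in reverse order (last step first). The map $\alpha\mapsto w(\alpha)$ is a bijection from $\mathbb{Q}\cap(0,1)$ to $LR$ words. Bracket of a frieze. For $\Gamma=\text{CCF}(w)$ put $\langle\Gamma\rangle:=v(\phi(\alpha))$, where $w=w(\alpha)$. This is well-defined (independent of the choice of $w$) up to replacing $A$ with $A^{-1}$. Notation. $\Lambda=\mathbb{Z}[A,A^{-1}]$, $\delta=-A^2-A^{-2}$, and $\Lambda^2=\Lambda[\infty]\oplus\Lambda[0]$ is the free $\Lambda$-module with basis $[\infty],[0]$. The map $v:\Lambda^2\to\Lambda$ is $v(a[\infty]+b[0])=a\delta+b$. Farey sums. Irreducible fractions have non-negative denominator, with $0=\frac01$, $\infty=\frac10$. Fractions $\frac pq,\frac rs$ (listed in ascending order) are Farey neighbors if $qr-ps=1$; their Farey sum is $\frac pq\sharp\frac rs=\frac{p+r}{q+s}$. Each positive rational $\alpha$ is $y\sharp z$ for a unique pair $(y,z)$ of Farey neighbors, called the pair of parents of $\alpha$. Ancestor triangle. Let $\alpha$ be a positive rational. Put $(y_1,z_1)=(\frac01,\frac10)$ and $m_i=y_i\sharp z_i$. If $m_i=\alpha$ stop and put $N=i$; otherwise $(y_{i+1},z_{i+1})=(m_i,z_i)$ if $\alpha>m_i$ and $(y_i,m_i)$ if $\alpha<m_i$. The ancestor triangle of $\alpha$ is the planar triangle with upper left corner $\frac01$, upper right corner $\frac10$ and bottom corner $\alpha$, decomposed into the $N$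 fundamental triangles with vertices $y_i$ (upper left), $z_i$ (upper right), $m_i$ (bottom), $i=1,\ldots,N$, the $(i+1)$-st glued below the $i$-th along the edge $y_{i+1}z_{i+1}$. Its left oblique side is the chain of edges through the distinct $y_i$'s from $\frac01$ down to $\alpha$, and its right oblique side is the chain of edges through the distinct $z_i$'s from $\frac10$ down to $\alpha$; $l(\alpha)$, $r(\alpha)$ are the numbers of edges on the left and right oblique sides. For $\ast\in\{0,\infty\}$, $P_\ast(\alpha)$ is the set of descending paths from $\ast$ to $\alpha$, i.e. edge paths in the ancestor triangle in which each step goes from a vertex to a vertex of which it is a parent. Such a path $\gamma$ cuts the ancestor triangle into a left and a right part; $w_L(\gamma)$, $w_R(\gamma)$ are the numbers of fundamental triangles on the left and on the right of $\gamma$. The map $\phi$ from the non-negative rationals together with $\infty$ to $\Lambda^2$ is defined by $\phi(\infty)=A^6[\infty]$, $\phi(0)=[0]$ and, for rational $\alpha>0$, $$\phi(\alpha)=\Bigl(A^6(-A^4)^{-r(\alpha)}\sum_{\gamma\in P_\infty(\alpha)}(-A^4)^{w_R(\gamma)}\Bigr)[\infty]+\Bigl((-A^4)^{l(\alpha)}\sum_{\gamma\in P_0(\alpha)}(-A^4)^{-w_L(\gamma)}\Bigr)[0].$$ *)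

(* Defs.v *)
From HB Require Import structures.
From mathcomp Require Import all_boot all_order all_algebra.
From mathcomp Require Import boolp zify.

Set Implicit Arguments.
Unset Strict Implicit.
Unset Printing Implicit Defensive.

Import Order.TTheory GRing.Theory Num.Theory.
Local Open Scope ring_scope.

(* Z[A, A^-1] is the subring of Q(A) of all p / A^n, p a polynomial. *)

Local Notation QA := {fraction {poly int}}.

Local Notation fracA := (FracField.tofrac 'X%R : QA).

Definition is_laurent : {pred QA} := fun x =>
  `[< exists (p : {poly int}) (n : nat), x = FracField.tofrac p / fracA ^+ n >].

Lemma fracA_neq0 : fracA != 0.
Proof. by rewrite tofrac_eq0 polyX_eq0. Qed.

Lemma is_laurentP (x : QA) :
  reflect (exists (p : {poly int}) (n : nat), x = FracField.tofrac p / fracA ^+ n)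
          (x \in is_laurent).
Proof. exact: asboolP. Qed.

Lemma is_laurent_subring : subring_closed is_laurent.
Proof.
have nz n : fracA ^+ n != 0 by rewrite expf_neq0 // fracA_neq0.
split.
- by apply/is_laurentP; exists 1, 0%N; rewrite tofrac1 expr0 divr1.
- move=> x y /is_laurentP[p [m ->]] /is_laurentP[q [n ->]].
  apply/is_laurentP; exists (p * 'X^n - q * 'X^m), (m + n)%N.
  rewrite tofracB !tofracM !tofracXn exprD mulrBl; congr (_ - _).
    by rewrite -mulf_div divff ?mulr1.
  by rewrite [fracA ^+ m * _]mulrC -mulf_div divff ?mulr1.
- move=> x y /is_laurentP[p [m ->]] /is_laurentP[q [n ->]].
  apply/is_laurentP; exists (p * q), (m + n)%N.
  by rewrite mulf_div tofracM exprD.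
Qed.

HB.instance Definition _ :=
  GRing.isSubringClosed.Build QA is_laurent is_laurent_subring.

Record laurent := Laurent { laurent_val : QA; _ : laurent_val \in is_laurent }.

HB.instance Definition _ := [isSub for laurent_val].
HB.instance Definition _ := [Choice of laurent by <:].
HB.instance Definition _ := [SubChoice_isSubComNzRing of laurent by <:].

Definition laurent_unit : {pred laurent} :=
  fun x => (x != 0) && ((val x)^-1 \in is_laurent).

(* The inverse in Q(A) when it is a Laurent polynomial, and x itself otherwise,
   as for every unitRingType. *)
Definition laurent_inv (x : laurent) : laurent := insubd x (val x)^-1.

Lemma laurent_mulVx : {in laurent_unit, left_inverse 1 laurent_inv *%R}.
Proof.
move=> x /andP[x0 xV]; apply: val_inj; rewrite rmorphM rmorph1 /= insubdK //.
apply: mulVf; apply: contra x0 => /eqP x0; apply/eqP/val_inj.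
by rewrite rmorph0.
Qed.

Lemma laurent_unitP (x y : laurent) : y * x = 1 -> laurent_unit x.
Proof.
move=> yx1; have x0 : x != 0.
  by apply: contra_eq_neq yx1 => ->; rewrite mulr0 eq_sym oner_neq0.
rewrite /laurent_unit x0; have := congr1 val yx1.
rewrite rmorphM rmorph1 /= => /mulr1_eq <-; rewrite invrK; exact: valP.
Qed.

Lemma laurent_inv_out : {in [predC laurent_unit], laurent_inv =1 id}.
Proof.
move=> x; rewrite inE /= negb_and negbK => /orP[/eqP->|xV].
  by apply: val_inj; rewrite val_insubd; case: ifP => // _; exact: invr0.
by apply: val_inj; rewrite val_insubd (negbTE xV).
Qed.

HB.instance Definition _ := GRing.ComNzRing_hasMulInverse.Build laurent
  laurent_mulVx laurent_unitP laurent_inv_out.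

Lemma laurent_integral : GRing.integral_domain_axiom laurent.
Proof.
move=> x y /(congr1 val) xy0; have : val x * val y == 0 by apply/eqP.
by rewrite mulf_eq0 => /orP[] /eqP z0; apply/orP; [left | right];
  apply/eqP/val_inj.
Qed.

HB.instance Definition _ :=
  GRing.ComUnitRing_isIntegral.Build laurent laurent_integral.

Lemma laurentA_subproof : fracA \in is_laurent.
Proof. by apply/is_laurentP; exists 'X, 0%N; rewrite expr0 divr1. Qed.

Definition A : laurent := Laurent laurentA_subproof.

Lemma A_unit : A \is a GRing.unit.
Proof.
rewrite unfold_in /= /laurent_unit; apply/andP; split.
  by apply: contra fracA_neq0 => /eqP/(congr1 val)/= ->; exact: eqxx.
by apply/is_laurentP; exists 1, 1%N; rewrite tofrac1 expr1 div1r.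
Qed.

Definition delta : laurent := - A ^+ 2 - A ^- 2.

(* The pair (a, b) stands for a[oo] + b[0]. *)
Definition laurent2 : Type := (laurent * laurent)%type.

Definition v (x : laurent2) : laurent := x.1 * delta + x.2.

(* A ring endomorphism of Z[A, A^-1] is determined by the image of A, so f is
   the substitution of A^-1 for A. *)
Definition eq_upto_inv (p q : laurent) : Prop :=
  p = q \/ exists2 f : {rmorphism laurent -> laurent}, f A = A^-1 & p = f q.

Notation "p '=dot=' q" := (eq_upto_inv p q) (at level 70) : type_scope.

(* (p, q) stands for p/q; infinity is (1, 0) and zero is (0, 1).  A fraction in
   the usual sense is a pair of coprime numbers; the Farey sum of neighbors is
   again such a pair. *)
Definition fareyfrac : Type := (nat * nat)%type.

Definition ffzero : fareyfrac := (0, 1)%N.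
Definition ffone : fareyfrac := (1, 1)%N.
Definition ffinf : fareyfrac := (1, 0)%N.

Definition farey_sum (x y : fareyfrac) : fareyfrac := (x.1 + y.1, x.2 + y.2)%N.

Definition fflt (x y : fareyfrac) : bool := (x.1 * y.2 < y.1 * x.2)%N.
Definition ffle (x y : fareyfrac) : bool := (x.1 * y.2 <= y.1 * x.2)%N.

(* The fundamental triangle with upper corners y, z is the pair (y, z). *)
Definition bottom (t : fareyfrac * fareyfrac) : fareyfrac := farey_sum t.1 t.2.

Fixpoint triangles_from (k : nat) (a y z : fareyfrac) :
    seq (fareyfrac * fareyfrac) :=
  if k is k'.+1 then
    (y, z) :: (let m := farey_sum y z in
               if m == a then [::]
               else if fflt m a then triangles_from k' a m z
               else triangles_from k' a y m)
  else [::].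

(* The fundamental triangles (y_i, z_i), i = 1, ..., N.  Numerator plus
   denominator of m_i is at least i.+1 and at most that of a, so the number of
   steps allowed is never reached. *)
Definition ancestor_triangle (a : fareyfrac) : seq (fareyfrac * fareyfrac) :=
  triangles_from (a.1 + a.2) a ffzero ffinf.

(* The vertices of the left (right) oblique side are a and the distinct y_i (z_i),
   so its edges are as many as the distinct y_i (z_i). *)
Definition left_length (a : fareyfrac) : nat :=
  size (undup [seq t.1 | t <- ancestor_triangle a]).
Definition right_length (a : fareyfrac) : nat :=
  size (undup [seq t.2 | t <- ancestor_triangle a]).

Definition is_parent (a : fareyfrac) : rel fareyfrac := fun x y =>
  has (fun t => (bottom t == y) && ((x == t.1) || (x == t.2)))
      (ancestor_triangle a).

(* The path is u :: s. *)
Definition descending_path (a u : fareyfrac) (s : seq fareyfrac) : bool :=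
  path (is_parent a) u s && (last u s == a).

(* Every vertex but the first of a descending path is some m_i, and i increases
   along the path: the tail of a path is a subsequence of m_1, ..., m_N. *)
Definition descending_tail (a : fareyfrac)
    (b : (size (ancestor_triangle a)).-tuple bool) : seq fareyfrac :=
  mask b [seq bottom t | t <- ancestor_triangle a].

(* The triangle (y, z), with bottom m, has its edge y--m on the left oblique
   side if m <= a, and its edge z--m on the right one if m >= a (both if
   m = a).  It lies in the part of the ancestor triangle cut off by the path
   u :: s that contains this edge: if the edge is on the left oblique side, the
   triangle is on the right of the path exactly when the path runs along it; if
   it is on the right oblique side, exactly when the path does not. *)
Definition on_right (a u : fareyfrac) (s : seq fareyfrac)
    (t : fareyfrac * fareyfrac) : bool :=
  let edges := zip (u :: s) s in
  if ffle (bottom t) a then (t.1, bottom t) \in edges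
  else (t.2, bottom t) \notin edges.

Definition w_R (a u : fareyfrac) (s : seq fareyfrac) : nat :=
  count (on_right a u s) (ancestor_triangle a).
Definition w_L (a u : fareyfrac) (s : seq fareyfrac) : nat :=
  count (fun t => ~~ on_right a u s t) (ancestor_triangle a).

Definition phi (a : fareyfrac) : laurent2 :=
  if a == ffinf then (A ^+ 6, 0)
  else if a == ffzero then (0, 1)
  else
    (A ^+ 6 * (- A ^+ 4) ^- right_length a *
       (\sum_(b : (size (ancestor_triangle a)).-tuple bool
              | descending_path a ffinf (descending_tail b))
          (- A ^+ 4) ^+ w_R a ffinf (descending_tail b)),
     (- A ^+ 4) ^+ left_length a *
       (\sum_(b : (size (ancestor_triangle a)).-tuple bool
              | descending_path a ffzero (descending_tail b))
          (- A ^+ 4) ^- w_L a ffzero (descending_tail b))).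

Inductive letter := L | R.
Definition LRword : Type := seq letter.

(* The vertex reached from the one with parents (y, z) by the downward path s. *)
Fixpoint tree_vertex (s : LRword) (y z : fareyfrac) : fareyfrac :=
  match s with
  | [::] => farey_sum y z
  | L :: s' => tree_vertex s' y (farey_sum y z)
  | R :: s' => tree_vertex s' (farey_sum y z) z
  end.

(* w = w(a): the downward path from 1/2 to a, written in reverse order, is w. *)
Definition word_of (a : fareyfrac) (w : LRword) : Prop :=
  tree_vertex (rev w) ffzero ffone = a.

(* There are [height] rows between the top row 0 and the bottom row height.+1.
   The entry j of row i is at horizontal position 2 j + i: its lower left
   neighbor is entry j - 1 of row i.+1, its lower right one is entry j of row
   i.+1, and its upper right one is entry j + 1 of row i.-1.  Entries of rows
   beyond height.+1 are meaningless. *)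
Record frieze := Frieze {
  height : nat;
  entry : nat -> int -> int;
  entry_gt0 : forall i j, (i <= height.+1)%N -> 0 < entry i j;
  top_row : forall j, entry 0%N j = 1;
  bottom_row : forall j, entry height.+1 j = 1;
  diamond : forall i j, (i < height)%N ->
    entry i.+1 j * entry i.+1 (j + 1) - entry i (j + 1) * entry i.+2 j = 1
}.

(* Horizontal position x becomes - x, so index j becomes - j - i in row i. *)
Definition mirror_entry (G : frieze) (i : nat) (j : int) : int :=
  entry G i (- j - i%:Z).

Lemma mirror_diamond (G : frieze) i j : (i < height G)%N ->
  mirror_entry G i.+1 j * mirror_entry G i.+1 (j + 1)
    - mirror_entry G i (j + 1) * mirror_entry G i.+2 j = 1.
Proof.
move=> /(diamond (- j - i.+2%:Z)) dia; apply: etrans dia.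
rewrite [in RHS]mulrC /mirror_entry.
by congr (_ * _ - _ * _); congr (entry G _ _); lia.
Qed.

Definition bot (G : frieze) : frieze :=
  @Frieze (height G) (mirror_entry G)
    (fun i j => entry_gt0 (- j - i%:Z))
    (fun j => top_row G (- j - 0%:Z))
    (fun j => bottom_row G (- j - (height G).+1%:Z))
    (@mirror_diamond G).

(* There is a 1 at (i, j) and then, following w, in each successive row. *)
Fixpoint ones_along (e : nat -> int -> int) (w : LRword) (i : nat) (j : int) :
    Prop :=
  e i j = 1 /\
  match w with
  | [::] => True
  | L :: w' => ones_along e w' i.+1 (j - 1)
  | R :: w' => ones_along e w' i.+1 j
  end.

(* G = CCF(w).  Friezes being considered up to horizontal translation, the line
   of 1's may start at any entry of the first row below the top row. *)
Definition is_CCF (w : LRword) (G : frieze) : Prop :=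
  height G = (size w).+1 /\ exists j : int, ones_along (entry G) w 1 j.

Definition zigzag_type (G : frieze) : Prop := exists w, is_CCF w G.

(* p = <G>.  A frieze may be CCF(w) for several words w, and <G> is only defined
   up to exchanging A and A^-1, hence a relation. *)
Definition is_bracket (G : frieze) (p : laurent) : Prop :=
  exists (a : fareyfrac) (w : LRword),
    [/\ word_of a w, is_CCF w G & p = v (phi a)].

(* Main.v *)
Require Import Defs.
From mathcomp Require Import all_boot all_order all_algebra.
From HB Require Import structures.
From mathcomp Require Import boolp zify ring lra.

(** Both sides can be computed from words.  Put q = -A^4.  The exponents that
    define the map phi are arranged so that the weight of a path in the ancestor
    triangle is a product over its edges, and summing over paths becomes a
    transfer-matrix computation: the bracket attached to a word is obtained by
    walking down the Stern-Brocot tree, starting from the pair (1, 1) and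
    replacing, at each letter, one entry of the pair (Y, Z) by q Y + q^-1 Z
    ([tree_value], [phi_tree_vertex]).

    Exchanging the letters L and R swaps Y and Z and exchanges q and q^-1, hence
    replaces A by its inverse ([tree_value_invA]).  Reversing the word does not
    change the value, because a symmetric matrix intertwines the matrices of both
    letters with their transposes ([tree_value_rev]).

    Reflecting a frieze exchanges the letters of its words, so what remains is
    to know all the words of one frieze.  A zigzag of 1's is a triangulation of a
    polygon with exactly two ears, and reading it from the other ear reverses the
    word and exchanges its letters.  In terms of entries: the diamond rule gives a
    linear recurrence, hence the glide reflection and the period of the frieze;
    diagonals labelled 1 do not cross, so that the only 1's in the row below the
    top one come from the two ears; and the start of a zigzag of 1's determines
    its word ([is_CCF_words]).  Both operations between words are covered by the
    two symmetries of the value. *)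

Set Implicit Arguments.
Unset Strict Implicit.
Unset Printing Implicit Defensive.

Import Order.TTheory GRing.Theory Num.Theory.
Local Open Scope ring_scope.

Definition swap (x : letter) : letter := if x is L then R else L.

Lemma swapK : involutive swap.
Proof. by case. Qed.

(** * Zigzags of 1's in a frieze *)

Section Frieze.
Variable G : frieze.
Local Notation n := (height G).
Local Notation e := (entry G).

Lemma entry_neq0 i j : (i <= n.+1)%N -> e i j != 0.
Proof. by move=> /(entry_gt0 j)/lt0r_neq0. Qed.

(** The frieze is a table of 2 x 2 minors of a solution of a second order linear
    recurrence whose coefficients are the row below the top one.  Positivity
    makes the diamond rule determine the next row, so the recurrence follows
    from it by induction on the row, after cancelling one entry. *)
Lemma recurrence_right i j : (i < n)%N ->
  e i.+2 j = e 1 (j + i.+1%:Z) * e i.+1 j - e i j.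
Proof.
elim: i j => [|i IH] j lin.
  have := diamond j lin; rewrite !top_row; lra.
have lin' : (i < n)%N by lia.
have := diamond j lin; have := diamond j lin'.
have := IH (j + 1) lin'.
have -> : j + 1 + i.+1%:Z = j + i.+2%:Z by lia.
move=> -> D1 D2; apply: (mulfI (@entry_neq0 i.+1 (j + 1) _)); first by lia.
lra.
Qed.

(** The same recurrence read along the other diagonals. *)
Lemma recurrence_left i j : (i < n)%N ->
  e i.+2 j = e 1 j * e i.+1 (j + 1) - e i (j + 2).
Proof.
elim: i j => [|i IH] j lin.
  have := diamond j lin; rewrite !top_row; lra.
have lin' : (i < n)%N by lia.
have := diamond j lin; have := diamond (j + 1) lin'.
have := IH j lin'.
have -> : j + 1 + 1 = j + 2 by lia.
move=> -> D1 D2; apply: (mulfI (@entry_neq0 i.+1 (j + 1) _)); first by lia.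
lra.
Qed.

Hypothesis n_gt0 : (0 < n)%N.

(** The row above the bottom one carries the same coefficients as the row below
    the top one: next to the bottom 1's, the recurrence and the diamond rule
    both express the same entry. *)
Lemma glide1 j : e 1 j = e n (j + 2).
Proof.
have lin : (n.-1 < n)%N by lia.
have := recurrence_left j lin; have := diamond (j + 1) lin.
rewrite prednK // !bottom_row.
have -> : j + 1 + 1 = j + 2 by lia.
move=> D1 D2; apply: (mulfI (@entry_neq0 n (j + 1) _)); first by lia.
lra.
Qed.

(** The glide reflection symmetry of friezes.  Two successive rows, read from
    the top along one recurrence and from the bottom along the other, satisfy
    the same recursion with the same initial rows. *)
Lemma glide i j : (i <= n.+1)%N -> e i j = e (n.+1 - i)%N (j + i.+1%:Z).
Proof.
suff main k : (k <= n)%N -> (forall j, e k j = e (n.+1 - k)%N (j + k.+1%:Z)) /\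
                   (forall j, e k.+1 j = e (n - k)%N (j + k.+2%:Z)).
  case: i => [|i] lin; first by case: (main 0%N isT).
  by case: (main i lin).
elim: k {i j} => [_|i IH lin].
  by split=> j; rewrite subn0 ?top_row ?bottom_row // glide1.
have [IH0 IH1] := IH (ltnW lin); split=> j; first by rewrite IH1 subSS.
have lin' : (n - i.+1 < n)%N by lia.
have := recurrence_left (j + i.+1%:Z) lin'.
rewrite (recurrence_right j) // IH0 IH1.
have -> : (n - i.+1).+2 = (n.+1 - i)%N by lia.
have -> : (n - i.+1).+1 = (n - i)%N by lia.
have -> : j + i.+1%:Z + 1 = j + i.+2%:Z by lia.
have -> : j + i.+1%:Z + 2 = j + i.+3%:Z by lia.
by move=> ->; lra.
Qed.

(** The glide reflection applied twice is a translation. *)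
Lemma period i j : (i <= n.+1)%N -> e i (j + n.+3%:Z) = e i j.
Proof.
move=> lin; rewrite [RHS]glide // [RHS]glide ?leq_subr // subKn //.
by congr (e i _); lia.
Qed.

(** In terms of a triangulated polygon with vertices the integers, entry [j] of
    row [i] belongs to the diagonal from [j] to [j + i + 1], and two diagonals
    labelled 1 do not cross.  Here one of them cuts off the vertex at the left
    end of the other (in the next lemma, at its right end), and the recurrence
    would write 1 as a sum of two positive entries. *)
Lemma no_crossing_left i j : (i < n)%N -> e i.+1 j = 1 -> e 1 (j - 1) != 1.
Proof.
move=> lin ij1; apply/eqP => j1.
have := recurrence_left (j - 1) lin.
rewrite j1 subrK ij1 => eq2.
have := @entry_gt0 G i.+2 (j - 1) ltac:(lia).
have := @entry_gt0 G i (j - 1 + 2) ltac:(lia).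
rewrite eq2; lia.
Qed.

Lemma no_crossing_right i j : (i < n)%N -> e i.+1 j = 1 ->
  e 1 (j + i.+1%:Z) != 1.
Proof.
move=> lin ij1; apply/eqP => j1.
have := recurrence_right j lin.
rewrite j1 ij1 => eq2.
have := @entry_gt0 G i.+2 j ltac:(lia).
have := @entry_gt0 G i j ltac:(lia).
rewrite eq2; lia.
Qed.

Fixpoint countL (w : LRword) : nat :=
  match w with
  | [::] => 0
  | L :: w' => (countL w').+1
  | R :: w' => countL w'
  end.

Lemma ones_along_start w i j : ones_along e w i j -> e i j = 1.
Proof. by case: w => [|x w] []. Qed.

(** The glide reflection turns the zigzag upside down: read from its other end
    it becomes another zigzag that starts in the row below the top one, with
    the letters exchanged.  The word [w'] accumulates the part of the image
    already read. *)
Lemma ones_along_glide w w' i j :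
  (i + size w <= n)%N -> ones_along e w i j ->
  ones_along e w' (n.+1 - i) (j + i.+1%:Z) ->
  ones_along e (map swap (rev w) ++ w') (n.+1 - (i + size w))
    (j - (countL w)%:Z + (i + size w).+1%:Z).
Proof.
elim: w w' i j => [|x w IH] w' i j /= lin.
  by rewrite addn0 subr0.
move=> [ij1 wx] w'1.
rewrite rev_cons map_rcons cat_rcons addnS -addSn.
have glw (k : int) : ones_along e w i.+1 k ->
    e (n - i)%N (k + i.+2%:Z) = 1.
  by move=> /ones_along_start <-; rewrite [RHS]glide; last lia; rewrite subSS.
case: x wx => wx; have e1 := glw _ wx.
- have := IH (R :: w') i.+1 (j - 1) ltac:(lia) wx.
  have -> : j - 1 - (countL w)%:Z = j - (countL (L :: w))%:Z by rewrite /=; lia.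
  apply; rewrite subSS /=; split=> //.
  move: w'1; congr (ones_along e w' _ _); lia.
- have := IH (L :: w') i.+1 j ltac:(lia) wx.
  apply; rewrite subSS /=; split=> //.
  move: w'1; congr (ones_along e w' _ _); lia.
Qed.

(** Both lower neighbors of a 1 cannot be 1, since the diamond above them would
    give a product of positive entries equal to 0; hence the starting point of
    a zigzag of 1's determines its letters. *)
Lemma ones_along_inj w w' i j : size w = size w' -> (0 < i)%N ->
  (i + size w <= n)%N -> ones_along e w i j -> ones_along e w' i j -> w = w'.
Proof.
elim: w w' i j => [|x w IH] [|x' w'] i j //= [sz] i0 lin [_ wx] [_ wx'].
have noLR k : e i.+1 (k - 1) = 1 -> e i.+1 k = 1 -> False.
  move=> k1 k2; have := @diamond G i (k - 1) ltac:(lia).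
  rewrite subrK k1 k2.
  have := @entry_gt0 G i k ltac:(lia).
  have := @entry_gt0 G i.+2 (k - 1) ltac:(lia).
  nia.
have st := ones_along_start.
case: x x' wx wx' => [] [] wx wx'; try by case: (noLR j); eauto.
  by congr (_ :: _); apply: IH wx wx'; lia.
by congr (_ :: _); apply: IH wx wx'; lia.
Qed.

(** The diagonals of the zigzag end at every vertex between its two extreme
    vertices but one, the first ear, and a vertex where a diagonal ends cannot
    be another ear.  The induction runs from the longest diagonal to the
    shortest, each step excluding the two ends of the current one. *)
Lemma ear_inside w i j k : (0 < i)%N -> (i + size w = n)%N ->
  ones_along e w i j -> e 1 (k - 1) = 1 ->
  j - (countL w)%:Z <= k <= j - (countL w)%:Z + n.+1%:Z ->
  j < k < j + i.+1%:Z.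
Proof.
move=> + + + k1.
have ends i' j' : (0 < i')%N -> (i' <= n)%N -> e i' j' = 1 ->
    (k != j') && (k != j' + i'.+1%:Z).
  case: i' => [|i'] // _ lin e1; apply/andP; split; apply/eqP => kE.
    by have := no_crossing_left lin e1; rewrite -kE k1 eqxx.
  have := no_crossing_right lin e1.
  have -> : j' + i'.+1%:Z = k - 1 by lia.
  by rewrite k1 eqxx.
elim: w i j => [|x w IH] i j i0 /= szw.
  by move=> [e1 _]; have /andP[/eqP? /eqP?] := ends _ _ i0 ltac:(lia) e1; lia.
case: x => -[e1 wx] kin; have /andP[/eqP? /eqP?] := ends _ _ i0 ltac:(lia) e1.
  by have := IH i.+1 (j - 1) isT ltac:(lia) wx ltac:(lia); lia.
by have := IH i.+1 j isT ltac:(lia) wx ltac:(lia); lia.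
Qed.

Lemma ones_along_period w i j (z : int) : (i + size w <= n)%N ->
  ones_along e w i j -> ones_along e w i (j + n.+3%:Z * z).
Proof.
have up w' i' j' : (i' + size w' <= n)%N ->
    (ones_along e w' i' (j' + n.+3%:Z) <-> ones_along e w' i' j').
  elim: w' i' j' => [|x w' IH] i' j' /= lin.
    by rewrite period //; lia.
  rewrite period; last by lia.
  case: x; last by rewrite IH; [by [] | lia].
  have -> : j' + n.+3%:Z - 1 = j' - 1 + n.+3%:Z by lia.
  by rewrite IH; [by [] | lia].
move=> lin; elim/int_rect: z j => [|m IH|m IH] j; first by rewrite mulr0 addr0.
  have -> : j + n.+3%:Z * m.+1%:Z = j + n.+3%:Z * m%:Z + n.+3%:Z by lia.
  by move=> /IH; rewrite up.
move=> /IH wm; apply/up => //.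
by have -> : j + n.+3%:Z * - m.+1%:Z + n.+3%:Z = j + n.+3%:Z * - m%:Z by lia.
Qed.

(** Up to translation by the period, a 1 in the row below the top one is an ear,
    and [ear_inside] leaves two of them: the start of the zigzag and the start of
    its image under the glide reflection. *)
Lemma zigzag_words w w' j j' : size w = n.-1 -> size w' = n.-1 ->
  ones_along e w 1 j -> ones_along e w' 1 j' ->
  w' = w \/ w' = map swap (rev w).
Proof.
move=> szw szw' w1 w'1.
(* The interval from [a] to [a + n + 1] supports the last diagonal; together
   with the remaining vertex [a + n + 2] it is a full period. *)
set a := j - (countL w)%:Z.
have := divz_eq (j' + 1 - a) n.+3%:Z.
have := ltz_mod (j' + 1 - a) (isT : n.+3%:Z != 0).
have := modz_ge0 (j' + 1 - a) (isT : n.+3%:Z != 0).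
set m := modz _ _; set d := divz _ _ => m0 m1 j'E.
have {w'1} := @ones_along_period w' 1 j' (- d) ltac:(lia) w'1.
set k := j' + _ => w'1.
have kE : k + 1 = a + m by rewrite /k; lia.
have [mn|mn] := lerP m n.+1%:Z.
  have := @ear_inside w 1 j (k + 1) isT ltac:(lia) w1.
  rewrite addrK (ones_along_start w'1) -/a => /(_ erefl ltac:(lia)) jk.
  left; apply: (@ones_along_inj w' w 1 j) => //; try lia.
  by have <- : k = j by lia.
right; apply: (@ones_along_inj _ _ 1 k); rewrite ?size_map ?size_rev //;
  try lia.
have e1 : e (n.+1 - 1)%N (j + 2%:Z) = 1.
  by rewrite -(ones_along_start w1) [RHS]glide.
have := @ones_along_glide w [::] 1 j ltac:(lia) w1 (conj e1 I).
rewrite cats0.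
have -> : (n.+1 - (1 + size w) = 1)%N by lia.
have -> : j - (countL w)%:Z + (1 + size w).+1%:Z = k by lia.
by apply.
Qed.

End Frieze.

Lemma ones_along_mirror G w i j :
  ones_along (mirror_entry G) w i j <->
  ones_along (entry G) (map swap w) i (- j - i%:Z).
Proof.
elim: w i j => [|[] w IH] i j //=; rewrite IH.
  by have -> : - (j - 1) - i.+1%:Z = - j - i%:Z by lia.
by have -> : - j - i.+1%:Z = - j - i%:Z - 1 by lia.
Qed.

Lemma is_CCF_bot w G : is_CCF w (bot G) <-> is_CCF (map swap w) G.
Proof.
rewrite /is_CCF size_map; split=> -[szw [j w1]]; split=> //.
  by exists (- j - 1); apply/ones_along_mirror.
exists (- j - 1); apply/ones_along_mirror.
by have -> : - (- j - 1) - 1%N%:Z = j by lia.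
Qed.

Lemma is_CCF_words w w' G : is_CCF w G -> is_CCF w' G ->
  w' = w \/ w' = map swap (rev w).
Proof.
move=> [szw [j w1]] [szw' [j' w'1]].
by apply: (@zigzag_words G) w1 w'1; lia.
Qed.

(** * Values along a path of the tree *)

Section Zigzag.
Variable K : comPzRingType.
Implicit Types s : LRword.

(** Kauffman bracket values along a downward path of the tree: [Y] is the value
    of the left parent and [Z] is [q] times the value of the right parent.  With
    this normalization the two letters play symmetric roles. *)
Fixpoint tree_value (q q' : K) s (Y Z : K) : K :=
  let M := q * Y + q' * Z in
  match s with
  | [::] => M
  | L :: s' => tree_value q q' s' Y M
  | R :: s' => tree_value q q' s' M Z
  end.

Lemma tree_value_swap (q q' : K) s Y Z :
  tree_value q q' (map swap s) Y Z = tree_value q' q s Z Y.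
Proof.
by elim: s Y Z => [|[] s IH] Y Z /=; rewrite addrC // IH.
Qed.

Variables (q q' : K).
Hypothesis qq' : q * q' = 1.

(** A letter replaces one coordinate of the vector of [Y] and [Z] by
    [q * Y + q' * Z]; this is the transpose of that linear map. *)
Definition transpose_step (d : K * K) (x : letter) : K * K :=
  if x is L then (d.1 + q * d.2, q' * d.2) else (q * d.1, q' * d.1 + d.2).

(** The symmetric matrix P of this form is the solution of two requirements: it
    intertwines the matrix M of each letter with its transpose (M P = P M^T),
    and it maps the vector of [q] and [q'] to that of 1 and 1. *)
Definition form (d d' : K * K) : K :=
  (q' - q' ^+ 2) * d.1 * d'.1 + d.1 * d'.2 + d.2 * d'.1
  + (q - q ^+ 2) * d.2 * d'.2.

Lemma formC d d' : form d d' = form d' d.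
Proof. by rewrite /form; ring. Qed.

Lemma form_step x d d' :
  form (transpose_step d x) d' = form d (transpose_step d' x).
Proof. by rewrite /form; case: x => /=; ring: qq'. Qed.

(** The arguments on the left are the coordinates of P d, and M P = P M^T moves
    P past all the letters. *)
Lemma tree_value_form s d :
  tree_value q q' s ((q' - q' ^+ 2) * d.1 + d.2) (d.1 + (q - q ^+ 2) * d.2)
  = form (foldl transpose_step d s) (q, q').
Proof.
elim: s d => [|x s IH] d /=; first by rewrite /form /=; ring.
rewrite -IH.
by case: x => /=; congr tree_value; ring: qq'.
Qed.

(** Write u for the vector of [q] and [q'], which is the final functional and
    satisfies P u = (1, 1).  The value is u^T M_k ... M_1 P u, and this is
    invariant under transposition, which reverses the order of the letters. *)
Lemma tree_value_rev s : tree_value q q' (rev s) 1 1 = tree_value q q' s 1 1.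
Proof.
have F s' : tree_value q q' s' 1 1
    = form (foldl transpose_step (q, q') s') (q, q').
  by rewrite -tree_value_form /=; congr tree_value; ring: qq'.
rewrite !F formC foldl_rev.
elim: s (q, q') {1 3}(q, q') => [|x s IH] d d' //=.
by rewrite -form_step IH.
Qed.

End Zigzag.

Lemma rmorph_tree_value (K K' : comPzRingType) (f : {rmorphism K -> K'})
    q q' (s : LRword) Y Z :
  f (tree_value q q' s Y Z) = tree_value (f q) (f q') s (f Y) (f Z).
Proof.
by elim: s Y Z => [|[] s IH] Y Z /=; rewrite ?IH rmorphD !rmorphM.
Qed.

(** * The ancestor triangle and its path sums *)

Local Notation triangle := (fareyfrac * fareyfrac)%type.
Implicit Types (a u x y z m : fareyfrac) (t : triangle) (T : seq triangle).
Implicit Types (s w : LRword) (G : frieze).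

(** The fundamental triangles met on the way down, read off the letters of the
    path instead of comparisons with the target vertex. *)
Fixpoint triangles_along s y z : seq triangle :=
  (y, z) :: match s with
            | [::] => [::]
            | L :: s' => triangles_along s' y (farey_sum y z)
            | R :: s' => triangles_along s' (farey_sum y z) z
            end.

Lemma fflt_irr x : fflt x x = false.
Proof. exact: ltnn. Qed.

Lemma fflt_neq x y : fflt x y -> x != y.
Proof. by apply: contraTneq => ->; rewrite fflt_irr. Qed.

Lemma ffleNlt x y : ffle x y = ~~ fflt y x.
Proof. by rewrite /ffle /fflt -leqNgt. Qed.

Lemma fflt_le x y : fflt x y -> ffle x y.
Proof. exact: ltnW. Qed.

Lemma fflt_suml y z : fflt y z -> fflt y (farey_sum y z).
Proof. by rewrite /fflt /=; nia. Qed.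

Lemma fflt_sumr y z : fflt y z -> fflt (farey_sum y z) z.
Proof. by rewrite /fflt /=; nia. Qed.

Definition cone_comb (b c : nat) y z : fareyfrac :=
  (b * y.1 + c * z.1, b * y.2 + c * z.2)%N.

(** All order and distinctness properties of the triangles come from this: below
    the edge from [y] to [z], every vertex is a nonnegative combination of [y]
    and [z], in which a left corner involves [y] and a right corner [z]. *)
Lemma triangles_along_cone s y z t : t \in triangles_along s y z ->
  exists b c b' c' : nat, [/\ (0 < b)%N, (0 < c')%N,
    t.1 = cone_comb b c y z & t.2 = cone_comb b' c' y z].
Proof.
have self u m : exists b c b' c' : nat, [/\ (0 < b)%N, (0 < c')%N,
    (u, m).1 = cone_comb b c u m & (u, m).2 = cone_comb b' c' u m].
  exists 1, 0, 0, 1; rewrite /cone_comb !mul0n !mul1n !addn0 !add0n.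
  by split=> //; apply: surjective_pairing.
elim: s y z => [|x s IH] y z /=; first by rewrite inE => /eqP ->; apply: self.
rewrite inE => /predU1P[->|]; first exact: self.
case: x => /IH[b [c [b' [c' [b0 c0 -> ->]]]]].
  exists (b + c)%N, c, (b' + c')%N, c'; rewrite /cone_comb /=.
  by split; rewrite ?addn_gt0 ?b0 //; congr (_, _); lia.
exists b, (b + c)%N, b', (b' + c')%N; rewrite /cone_comb /=.
by split; rewrite ?addn_gt0 ?c0 ?orbT //; congr (_, _); lia.
Qed.

Lemma triangles_along_gt s y z t u : t \in triangles_along s y z ->
  fflt u y -> fflt u z -> fflt u t.1 && fflt u t.2.
Proof.
move=> /triangles_along_cone[b [c [b' [c' [b0 c0 -> ->]]]]].
by rewrite /fflt /=; nia.
Qed.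

Lemma triangles_along_lt s y z t u : t \in triangles_along s y z ->
  fflt y u -> fflt z u -> fflt t.1 u && fflt t.2 u.
Proof.
move=> /triangles_along_cone[b [c [b' [c' [b0 c0 -> ->]]]]].
by rewrite /fflt /=; nia.
Qed.

Lemma bottom_between s y z t : t \in triangles_along s y z -> fflt y z ->
  fflt y (bottom t) && fflt (bottom t) z.
Proof.
case: t => t1 t2.
move=> /triangles_along_cone[b [c [b' [c' [b0 c0 /= -> ->]]]]].
by rewrite /fflt /=; nia.
Qed.

Lemma triangles_along_corners s y z t : t \in triangles_along s y z ->
  fflt y z -> fflt t.1 t.2.
Proof.
elim: s y z => [|x s IH] y z /=; first by rewrite inE => /eqP ->.
rewrite inE => /predU1P[-> //|]; case: x => /IH lt yz; apply: lt.
  exact: fflt_suml.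
exact: fflt_sumr.
Qed.

Lemma tree_vertex_bottom s y z :
  tree_vertex s y z \in [seq bottom t | t <- triangles_along s y z].
Proof. by elim: s y z => [|[] s IH] y z; rewrite inE ?eqxx //= IH orbT. Qed.

Lemma tree_vertex_between s y z : fflt y z ->
  fflt y (tree_vertex s y z) && fflt (tree_vertex s y z) z.
Proof.
move=> yz; have /mapP[t /bottom_between tin ->] := tree_vertex_bottom s y z.
exact: tin.
Qed.

Lemma uniq_map_inj (X Y : eqType) (f : X -> Y) (l : seq X) :
  uniq (map f l) -> {in l &, injective f}.
Proof.
elim: l => [//|x l IH] /= /andP[fx /IH inj] u w.
rewrite !inE => /predU1P[->|ul] /predU1P[->|wl] // fuw; last exact: inj.
  by case/mapP: fx; exists w.
by case/mapP: fx; exists u.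
Qed.

Lemma bottom_uniq s y z : fflt y z ->
  uniq [seq bottom t | t <- triangles_along s y z].
Proof.
elim: s y z => [//|x s IH] y z yz.
have ym := fflt_suml yz; have mz := fflt_sumr yz.
case: x; rewrite /= IH // andbT; apply/mapP => -[t /bottom_between tin] mE.
  by move: (tin ym); rewrite -mE /bottom /= fflt_irr andbF.
by move: (tin mz); rewrite -mE /bottom /= fflt_irr.
Qed.

Lemma triangles_from_tree_vertex s k y z : fflt y z -> (size s < k)%N ->
  triangles_from k (tree_vertex s y z) y z = triangles_along s y z.
Proof.
elim: s k y z => [|x s IH] [|k] y z yz //= sk; first by rewrite eqxx.
have ym := fflt_suml yz; have mz := fflt_sumr yz.
case: x.
  have /andP[_ am] := tree_vertex_between s ym.
  rewrite eq_sym (negbTE (fflt_neq am)); have:= fflt_le am.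
  by rewrite ffleNlt => /negbTE ->; rewrite IH.
have /andP[ma _] := tree_vertex_between s mz.
by rewrite (negbTE (fflt_neq ma)) ma IH.
Qed.

(** Each step down adds a corner, whose numerator and denominator are not both 0,
    to the vertex reached; this bounds the number of triangles. *)
Lemma size_tree_vertex s y z : (0 < y.1 + y.2)%N -> (0 < z.1 + z.2)%N ->
  (size s + (y.1 + y.2 + (z.1 + z.2)) <= (tree_vertex s y z).1 +
    (tree_vertex s y z).2)%N.
Proof.
elim: s y z => [|[] s IH] y z y0 z0 /=; first by lia.
  by have := IH y (farey_sum y z) y0 ltac:(rewrite /=; lia); rewrite /=; lia.
by have := IH (farey_sum y z) z ltac:(rewrite /=; lia) z0; rewrite /=; lia.
Qed.

(** A new left corner appears exactly after a step to the right, that is after a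
    bottom below the target; the target itself accounts for the first corner. *)
Lemma size_left_corners s y z : fflt y z ->
  size (undup [seq t.1 | t <- triangles_along s y z])
  = count (fun t => ffle (bottom t) (tree_vertex s y z)) (triangles_along s y z).
Proof.
elim: s y z => [|x s IH] y z yz; first by rewrite /= /ffle leqnn.
have ym := fflt_suml yz; have mz := fflt_sumr yz.
case: x; rewrite /=.
  have /andP[_ am] := tree_vertex_between s ym.
  rewrite ffleNlt am add0n -IH //.
  by case: s {IH am} => [|x s]; rewrite /= inE eqxx.
have /andP[ma _] := tree_vertex_between s mz.
rewrite fflt_le // ifN /= ?IH //.
apply/mapP => -[t /triangles_along_gt tin] yE.
by have := tin _ ym yz; rewrite yE fflt_irr.
Qed.

Lemma size_right_corners s y z : fflt y z ->
  size (undup [seq t.2 | t <- triangles_along s y z])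
  = (count (fun t => ~~ ffle (bottom t) (tree_vertex s y z))
           (triangles_along s y z)).+1.
Proof.
elim: s y z => [|x s IH] y z yz; first by rewrite /= /ffle leqnn.
have ym := fflt_suml yz; have mz := fflt_sumr yz.
case: x; rewrite /=.
  have /andP[_ am] := tree_vertex_between s ym.
  rewrite ffleNlt am ifN /= ?IH //.
  apply/mapP => -[t /triangles_along_lt tin] zE.
  by have := tin _ yz mz; rewrite zE fflt_irr andbF.
have /andP[ma _] := tree_vertex_between s mz.
rewrite fflt_le //= add0n -IH //.
by case: s {IH ma} => [|x s]; rewrite /= inE eqxx.
Qed.

Section PathSum.
Variables (K : comPzRingType) (q q' : K).
Hypothesis qq' : q * q' = 1.

Lemma big_tuple_cons n (F : seq bool -> K) :
  \sum_(b : n.+1.-tuple bool) F b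
  = \sum_(b : n.-tuple bool) F (false :: b)
    + \sum_(b : n.-tuple bool) F (true :: b).
Proof.
rewrite (reindex (fun p : bool * n.-tuple bool => [tuple of p.1 :: p.2])) /=;
  last first.
  exists (fun b : n.+1.-tuple bool => (thead b, [tuple of behead b]))
      => [[c b]|b] _ /=.
    by congr (_, _); apply: val_inj.
  by apply: val_inj; case/tupleP: b => c b.
rewrite -(pair_big xpredT xpredT (fun c (b : n.-tuple bool) => F (c :: b))) /=.
by rewrite big_bool addrC.
Qed.

(** The factor by which an edge from [x] to the bottom of [t] changes the weight
    of a path.  The exponent of [q] counts triangles on the right of the path,
    and each triangle hanging from the right side of the ancestor triangle (its
    bottom is above [a]) is counted unless the path runs along its right edge.
    Dividing by [q] for every such triangle leaves weight 1 for the triangles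
    that the path skips, so that the weight becomes a product over the edges of
    the path. *)
Definition edge_weight a x t : K :=
  if x == t.1 then (if ffle (bottom t) a then q else 1)
  else if x == t.2 then (if ffle (bottom t) a then 1 else q')
  else 0.

(** The total weight of the descending paths from [x] to [a] through the
    triangles of [T], which are listed downwards. *)
Fixpoint walk_sum a x T : K :=
  match T with
  | [::] => (x == a)%:R
  | t :: T' => walk_sum a x T' + edge_weight a x t * walk_sum a (bottom t) T'
  end.

Lemma mem_zip_snd (X Y : eqType) (l : seq X) (l' : seq Y) p :
  p \in zip l l' -> p.2 \in l'.
Proof.
elim: l l' => [|x l IH] [|y l'] //=; rewrite !inE.
by case/predU1P => [->|/IH ->]; rewrite ?eqxx ?orbT.
Qed.

Lemma on_right_avoid a x (l : seq fareyfrac) t : bottom t \notin l ->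
  on_right a x l t = ~~ ffle (bottom t) a.
Proof.
move=> tl; have notin u : (u, bottom t) \notin zip (x :: l) l.
  by apply: contra tl => /mem_zip_snd.
by rewrite /on_right (negbTE (notin _)) notin; case: ifP.
Qed.

Lemma on_right_skip a x m (l : seq fareyfrac) t : bottom t != m ->
  on_right a x (m :: l) t = on_right a m l t.
Proof. by move=> tm; rewrite /on_right /= !inE !xpair_eqE (negbTE tm) !andbF. Qed.

Lemma on_right_step a x (l : seq fareyfrac) t : bottom t \notin l ->
  on_right a x (bottom t :: l) t
  = if ffle (bottom t) a then t.1 == x else t.2 != x.
Proof.
move=> tl; have notin u : (u, bottom t) \notin zip (bottom t :: l) l.
  by apply: contra tl => /mem_zip_snd.
by rewrite /on_right /= !inE !xpair_eqE !(negbTE (notin _)) !eqxx /= !andbT !orbF.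
Qed.

(** A mask encodes which bottoms are visited.  Its head decides whether the first
    triangle is skipped or entered; the bottoms being distinct, the position of
    that triangle with respect to the path depends on this choice alone, and the
    other triangles only see the rest of the path. *)
Lemma path_sum a (par : rel fareyfrac) x T :
  uniq [seq bottom t | t <- T] ->
  {in T, forall t x, par x (bottom t) = (x == t.1) || (x == t.2)} ->
  {in T, forall t, t.1 != t.2} ->
  \sum_(b : (size T).-tuple bool
          | let l := mask b [seq bottom t | t <- T] in
            path par x l && (last x l == a))
     q ^+ count (on_right a x (mask b [seq bottom t | t <- T])) T
  = q ^+ count (fun t => ~~ ffle (bottom t) a) T * walk_sum a x T.
Proof.
rewrite big_mkcond.
pose F x T (b : seq bool) := let l := mask b [seq bottom t | t <- T] in
  if path par x l && (last x l == a) then q ^+ count (on_right a x l) T else 0.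
rewrite -[LHS]/(\sum_(b : (size T).-tuple bool) F x T b).
elim: T x => [|t T IH] x /=.
  move=> _ _ _; rewrite (eq_bigr (fun=> (x == a)%:R)); last first.
    by move=> b _; rewrite /F tuple0 /=; case: eqP.
  by rewrite big_const card_tuple /= addr0 mul1r.
move=> /andP[tT uT] par_t neq_t.
have tl b : bottom t \notin mask b [seq bottom t | t <- T].
  by apply: contra tT => /mem_mask.
have {}IH x' : \sum_(b : (size T).-tuple bool) F x' T b
   = q ^+ count (fun t => ~~ ffle (bottom t) a) T * walk_sum a x' T.
  by apply: IH => // t' t'T; [apply: par_t | apply: neq_t]; rewrite inE t'T orbT.
rewrite big_tuple_cons exprD mulrDr.
congr (_ + _).
  rewrite -mulrA -IH mulr_sumr; apply: eq_bigr => b _.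
  rewrite /F /= on_right_avoid // exprD; case: ifP; rewrite ?mulr0 //.
rewrite mulrCA -mulrA -[in RHS]IH mulrA mulr_sumr; apply: eq_bigr => b _.
rewrite /F /= par_t ?inE ?eqxx // on_right_step //.
have -> : count (on_right a x (bottom t :: mask b [seq bottom t | t <- T])) T =
    count (on_right a (bottom t) (mask b [seq bottom t | t <- T])) T.
  apply: eq_in_count => t' t'T; apply: on_right_skip.
  by apply: contra tT => /eqP <-; apply: map_f.
set c := count _ T; set ok := path _ _ _ && _.
have := neq_t t (mem_head _ _); rewrite /edge_weight -andbA -/ok.
rewrite [t.1 == x]eq_sym [t.2 == x]eq_sym.
case: ok; last by rewrite !andbF !mulr0.
rewrite !andbT; case: (x =P t.1) => [->|_] /= t12.
  by rewrite t12; case: (ffle _ _); rewrite exprD ?expr0 ?mulr1 ?mul1r.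
case: (x == t.2); last by rewrite !mul0r.
by case: (ffle _ _); rewrite exprD /= expr0 ?expr1 ?[q' * q]mulrC ?qq' !mul1r.
Qed.

Lemma walk_sum_eq0 a x T :
  x != a -> {in T, forall t, (x != t.1) && (x != t.2)} ->
  walk_sum a x T = 0.
Proof.
move=> xa; elim: T => [|t T IH] xT /=; first by rewrite (negbTE xa).
rewrite IH; last by move=> t' t'T; apply: xT; rewrite inE t'T orbT.
have /andP[x1 x2] := xT t (mem_head _ _).
by rewrite /edge_weight (negbTE x1) (negbTE x2) mul0r addr0.
Qed.

(** Duality between the two directions: [walk_sum] is computed upwards from [a],
    [tree_value] downwards from the edge from [y] to [z].  At each step the
    corner that is dropped starts no further path, and the other two paths are
    exactly those of the next edge, with the value transported to it. *)
Lemma walk_sum_tree_value s y z Y Z : fflt y z ->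
  let a := tree_vertex s y z in let T := triangles_along s y z in
  Y * walk_sum a y T + q' * Z * walk_sum a z T = tree_value q q' s Y Z.
Proof.
elim: s y z Y Z => [|x s IH] y z Y Z yz /=;
  have ym := fflt_suml yz; have mz := fflt_sumr yz.
  rewrite /edge_weight /= /bottom /= !eqxx /ffle leqnn.
  rewrite (negbTE (fflt_neq ym)) [z == _]eq_sym (negbTE (fflt_neq mz)).
  by rewrite [z == _]eq_sym (negbTE (fflt_neq yz)) /=; ring.
case: x.
  have /andP[ya am] := tree_vertex_between s ym.
  rewrite -(IH y (farey_sum y z)) // /edge_weight /bottom /= !eqxx [z == y]eq_sym.
  rewrite (negbTE (fflt_neq yz)) ffleNlt am /= [walk_sum _ z _]walk_sum_eq0.
  - by ring: qq'.
  - by rewrite eq_sym fflt_neq //; have /andP[] := tree_vertex_between (L :: s) yz.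
  - move=> t /triangles_along_lt tin; have /andP[t1 t2] := tin _ yz mz.
    by rewrite ![z == _]eq_sym !fflt_neq.
have /andP[ma az] := tree_vertex_between s mz.
rewrite -(IH (farey_sum y z) z) // /edge_weight /bottom /= !eqxx [z == y]eq_sym.
rewrite (negbTE (fflt_neq yz)) fflt_le // [walk_sum _ y _]walk_sum_eq0.
- by ring: qq'.
- by rewrite fflt_neq //; have /andP[] := tree_vertex_between (R :: s) yz.
- move=> t /triangles_along_gt tin; have /andP[t1 t2] := tin _ ym yz.
  by rewrite !fflt_neq.
Qed.

End PathSum.

(** * Inverting the variable of Laurent polynomials *)

(** Evaluation at [A] identifies integer polynomials with a subring of the
    Laurent polynomials, in which every element becomes a polynomial after
    multiplication by a power of [A]; evaluation at the inverse of [A] then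
    extends to a substitution on all Laurent polynomials. *)
Definition evalz (b : laurent) (p : {poly int}) : laurent :=
  (map_poly intr p).[b].

Lemma evalzB b p p' : evalz b (p - p') = evalz b p - evalz b p'.
Proof. by rewrite /evalz rmorphB hornerD hornerN. Qed.

Lemma evalzM b p p' : evalz b (p * p') = evalz b p * evalz b p'.
Proof. by rewrite /evalz rmorphM hornerM. Qed.

Lemma evalz1 b : evalz b 1 = 1.
Proof. by rewrite /evalz rmorph1 hornerC. Qed.

Lemma evalzXn b n : evalz b 'X^n = b ^+ n.
Proof. by rewrite /evalz map_polyXn hornerXn. Qed.

Lemma val_evalzA p : val (evalz A p) = FracField.tofrac p.
Proof.
elim/poly_ind: p => [|p c IH].
  by rewrite /evalz rmorph0 horner0 tofrac0.
have -> : evalz A (p * 'X + c%:P) = evalz A p * A + c%:~R.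
  by rewrite /evalz rmorphD rmorphM /= map_polyX map_polyC /= hornerMXaddC.
rewrite rmorphD rmorphM rmorph_int tofracD tofracM -IH.
by congr (_ + _); rewrite -[c in RHS]intz !rmorph_int.
Qed.

Lemma evalzA_inj : injective (evalz A).
Proof.
move=> p p' /(congr1 val); rewrite !val_evalzA => /eqP.
by rewrite tofrac_eq => /eqP.
Qed.

Lemma A_exp_unit n : A ^+ n \is a GRing.unit.
Proof. by rewrite unitrX // A_unit. Qed.

Lemma laurent_poly (x : laurent) :
  exists pn : {poly int} * nat, x * A ^+ pn.2 = evalz A pn.1.
Proof.
have /is_laurentP[p [n xE]] := valP x.
exists (p, n); apply: val_inj; rewrite val_evalzA rmorphM rmorphXn /= xE.
by rewrite mulfVK // expf_neq0 // fracA_neq0.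
Qed.

(** The substitution of [A^-1] for [A].  As [x = p(A) / A^n], its image is
    [p(A^-1) * A^n]. *)
Definition invA (x : laurent) : laurent :=
  let pn := sval (cid (laurent_poly x)) in evalz A^-1 pn.1 * A ^+ pn.2.

(** Two presentations of [x] differ by a polynomial identity, by injectivity of
    evaluation at [A]; evaluating this identity at [A^-1] shows that the image
    is independent of the choice. *)
Lemma invAE (x : laurent) p n :
  x * A ^+ n = evalz A p -> invA x = evalz A^-1 p * A ^+ n.
Proof.
rewrite /invA; case: cid => -[p' n'] /= xE' xE.
have : evalz A (p' * 'X^n) = evalz A (p * 'X^n').
  by rewrite !evalzM !evalzXn -xE -xE'; ring.
move=> /evalzA_inj/(congr1 (evalz A^-1)); rewrite !evalzM !evalzXn => eqpp.
have AV (k : nat) : A ^+ k * A^-1 ^+ k = 1 by rewrite exprVn divrr // A_exp_unit.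
move: (AV n) (AV n') eqpp.
move: (A ^+ n) (A^-1 ^+ n) (A ^+ n') (A^-1 ^+ n') => a b a' b' ab ab' eqpp.
by rewrite -[LHS]mulr1 -ab [a * b]mulrC mulrACA eqpp; ring: ab'.
Qed.

Lemma invA_is_zmod_morphism : zmod_morphism invA.
Proof.
move=> x y; have [[p m] /= xE] := laurent_poly x.
have [[p' n] /= yE] := laurent_poly y.
rewrite (invAE xE) (invAE yE).
rewrite (@invAE _ (p * 'X^n - p' * 'X^m) (m + n)%N); last first.
  by rewrite evalzB !evalzM !evalzXn -xE -yE exprD; ring.
rewrite evalzB !evalzM !evalzXn exprD.
have AV (k : nat) : A^-1 ^+ k * A ^+ k = 1 by rewrite exprVn mulVr // A_exp_unit.
move: (AV m) (AV n).
move: (A ^+ m) (A^-1 ^+ m) (A ^+ n) (A^-1 ^+ n) => a b a' b' ab ab'.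
ring: ab ab'.
Qed.

Lemma invA_is_monoid_morphism : monoid_morphism invA.
Proof.
split=> [|x y].
  by rewrite (@invAE _ 1 0) !evalz1 ?expr0 ?mulr1.
have [[p m] /= xE] := laurent_poly x; have [[p' n] /= yE] := laurent_poly y.
rewrite (invAE xE) (invAE yE) (@invAE _ (p * p') (m + n)%N) evalzM exprD.
  by ring.
by rewrite -xE -yE; ring.
Qed.

HB.instance Definition _ :=
  GRing.isZmodMorphism.Build laurent laurent invA invA_is_zmod_morphism.
HB.instance Definition _ :=
  GRing.isMonoidMorphism.Build laurent laurent invA invA_is_monoid_morphism.

Lemma invA_A : invA A = A^-1.
Proof. by rewrite (@invAE _ 'X^1 0%N) ?evalzXn ?expr0 ?mulr1. Qed.

(** * The bracket of a frieze of zigzag type *)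

Definition qA : laurent := - A ^+ 4.

Lemma qA_unit : qA \is a GRing.unit.
Proof. by rewrite unitrN A_exp_unit. Qed.

Lemma invA_qA : invA qA = qA^-1.
Proof. by rewrite /qA rmorphN rmorphXn /= invA_A invrN exprVn. Qed.

(** The weights of both families of paths in the definition of the map phi have
    the same normal form: the number of right corners exceeds by one the number
    of triangles with bottom above [a], and the left corners are as many as the
    other triangles.  What remains are the values of [v] at infinity and 0,
    1 - q and 1, so that the vertex 1 has value [q^-1]. *)
Lemma phi_tree_vertex s : let a := tree_vertex s ffzero ffone in
  v (phi a) = tree_value qA qA^-1 s 1 1.
Proof.
set a := tree_vertex s ffzero ffone => /=.
(* One more step to the left leads from the edge 0, infinity to the edge 0, 1. *)
have aE : a = tree_vertex (L :: s) ffzero ffinf by [].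
have lt0i : fflt ffzero ffinf by [].
set T := triangles_along (L :: s) ffzero ffinf.
have TE : ancestor_triangle a = T.
  rewrite /ancestor_triangle aE triangles_from_tree_vertex //.
  by have := @size_tree_vertex (L :: s) ffzero ffinf isT isT; rewrite /=; lia.
have /andP[lt0a ltai] := tree_vertex_between (L :: s) lt0i.
rewrite -aE in lt0a ltai.
have paths x := @path_sum laurent qA qA^-1 (divrr qA_unit) a (is_parent a) x
  (ancestor_triangle a).
have {}paths x : \sum_(b : (size (ancestor_triangle a)).-tuple bool
           | descending_path a x (descending_tail b))
      qA ^+ w_R a x (descending_tail b)
   = qA ^+ count (fun t => ~~ ffle (bottom t) a) T * walk_sum qA qA^-1 a x T.
  rewrite -TE; apply: paths; rewrite TE.
  - exact: bottom_uniq.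
  - move=> t tT u; rewrite /is_parent TE; apply/hasP/idP => [[t' t'T]|ut].
      case/andP=> /eqP bE; have -> // : t' = t.
      exact: (uniq_map_inj (bottom_uniq _ lt0i) t'T tT bE).
    by exists t => //; rewrite eqxx.
  - by move=> t /triangles_along_corners/(_ lt0i)/fflt_neq.
rewrite /v /phi ifN_eq; last by rewrite fflt_neq.
rewrite ifN_eq; last by rewrite eq_sym fflt_neq.
have pathsL x : \sum_(b : (size (ancestor_triangle a)).-tuple bool
           | descending_path a x (descending_tail b))
      qA ^- w_L a x (descending_tail b)
   = qA ^- count (fun t => ffle (bottom t) a) T * walk_sum qA qA^-1 a x T.
  have -> : qA ^- count (fun t => ffle (bottom t) a) T
      = qA ^- size T * qA ^+ count (fun t => ~~ ffle (bottom t) a) T.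
    rewrite -(count_predC (fun t => ffle (bottom t) a) T) exprD.
    by rewrite invrM ?unitrX ?qA_unit // mulrC mulVKr // unitrX // qA_unit.
  rewrite -mulrA -paths mulr_sumr; apply: eq_bigr => b _.
  have -> : size T =
      (w_L a x (descending_tail b) + w_R a x (descending_tail b))%N.
    by rewrite addnC -TE -(count_predC (on_right a x (descending_tail b))).
  by rewrite exprD invrM ?unitrX ?qA_unit // mulrC mulVKr // unitrX // qA_unit.
rewrite /= -/qA paths pathsL /left_length /right_length TE.
rewrite size_left_corners // size_right_corners // -aE -/T.
(* The value of [v] at infinity: [qA^-1] comes from the extra right corner. *)
have first_triangle : A ^+ 6 / qA * delta = 1 - qA.
  apply: (mulrI qA_unit); rewrite mulrA mulrCA divrr ?qA_unit // mulr1.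
  by have := A_exp_unit 2; rewrite /delta /qA => A2; ring: (divrr A2).
rewrite mulVKr ?unitrX ?qA_unit // (exprS qA) invrM ?unitrX ?qA_unit //.
move: (A ^+ 6) first_triangle => A6 first_triangle.
rewrite [qA ^- _ / qA]mulrC -!mulrA mulKr ?unitrX ?qA_unit //.
rewrite [walk_sum _ _ _ _ _ * _]mulrC !mulrA first_triangle.
have : 1 * walk_sum qA qA^-1 a ffzero T
       + qA^-1 * (qA * (1 - qA)) * walk_sum qA qA^-1 a ffinf T
     = tree_value qA qA^-1 (L :: s) 1 (qA * (1 - qA)).
  exact: (walk_sum_tree_value (divrr qA_unit) (L :: s) _ _ lt0i).
rewrite mul1r mulKr ?qA_unit // addrC => ->.
by rewrite /= mulr1 mulKr ?qA_unit // addrC subrK.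
Qed.

Lemma is_bracketE G p : is_bracket G p <->
  exists2 w, is_CCF w G & p = tree_value qA qA^-1 (rev w) 1 1.
Proof.
split=> [[a [w [<- Gw ->]]]|[w Gw ->]].
  by exists w; rewrite ?phi_tree_vertex.
by exists (tree_vertex (rev w) ffzero ffone), w; rewrite phi_tree_vertex.
Qed.

(** Both operations exchange the two parents and invert [q]. *)
Lemma tree_value_invA s :
  tree_value qA qA^-1 (map swap s) 1 1 = invA (tree_value qA qA^-1 s 1 1).
Proof.
rewrite tree_value_swap rmorph_tree_value /= rmorph1.
by rewrite (rmorphV _ qA_unit) /= invA_qA invrK.
Qed.

Theorem theorem3p15 (G : frieze) (hG : zigzag_type G) :
  (exists p : laurent, is_bracket (bot G) p) /\
  (forall p q : laurent, is_bracket (bot G) p -> is_bracket G q -> p =dot= q).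
Proof.
split.
  case: hG => w Gw; exists (tree_value qA qA^-1 (rev (map swap w)) 1 1).
  apply/is_bracketE; exists (map swap w) => //.
  by apply/is_CCF_bot; rewrite (mapK swapK).
move=> p q /is_bracketE[w /is_CCF_bot Gw ->] /is_bracketE[w' Gw' ->].
have [wE|/(inj_map (inv_inj swapK)) ->] := is_CCF_words Gw' Gw.
  right; exists (invA : {rmorphism laurent -> laurent}); first exact: invA_A.
  by rewrite -wE /= -tree_value_invA map_rev (mapK swapK).
by left; rewrite revK (tree_value_rev (divrr qA_unit)).
Qed.
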